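(* For every $n\geq 1$, $$D_nD_{n-1}\cdots D_1(z_0)=T_n(\mathbf{x},\mathbf{y},\mathbf{z}),$$ where $$T_n(\mathbf{x},\mathbf{y},\mathbf{z})=\sum_{\pi\in\bar Q_n}\prod_{i\in A(\pi)}x_{\pi_i}\prod_{i\in D(\pi)}y_{\pi_i}\prod_{i\in P(\pi)}z_{\pi_i}$$ and, for each $n\geq 1$, $D_n$ is the formal derivative associated with the context-free grammar $$G_n=\{x_i\rightarrow x_ny_nz_n,\ y_i\rightarrow 2x_ny_nz_n,\ z_i\rightarrow x_ny_nz_n,\ 0\leq i<n\}.$$
   Context: The $x_i,y_i,z_i$ ($i\geq 0$) are independent commuting variables (letters). A context-free grammar $G$ is a set of production rules $\text{letter}\rightarrow\text{polynomial}$. The formal derivative $D$ associated with $G$ is the linear operator on polynomials in the letters that satisfies the Leibniz rule $D(fg)=D(f)g+fD(g)$ and sends each letter to the right-hand side of its production rule. (In the expression above, $D_m$ is only applied to polynomials in letters with index less than $m$; letters without a rule may be sent to $0$.) Let $[n]_2$ be the multiset $\{1,1,2,2,\ldots,n,n\}$. A Stirling permutation of $[n]_2$ is a permutation $\pi=\pi_1\cdots\pi_{2n}$ of $[n]_2$ such that if $\pi_i=\pi_j$ then $\pi_k>\pi_i$ whenever $i<k<j$. Set $\pi_0=\pi_{2n+1}=0$. A marked Stirling permutation of $[n]_2$ is a Stirling permutation $\pi$ of $[n]_2$ together with a (possibly empty) set of marked positions, where position $i$ is allowed to be marked only if $\pi_i$ is the second occurrence of its value in $\pi$ (reading from left to right)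 and $\pi_i<\pi_{i+1}$. Let $\bar Q_n$ be the set of marked Stirling permutations of $[n]_2$. Marks are ignored in all comparisons of entries and in the indices of variables. For $\pi\in\bar Q_n$ define the subsets of $\{1,\ldots,2n\}$: $A(\pi)=\{i:\pi_{i-1}<\pi_i\}$, $D(\pi)=\{i:\pi_i>\pi_{i+1}\}$, $P(\pi)=\{i:\pi_{i-1}=\pi_i\}$. *)

(* Defs.v *)
From HB Require Import structures.
From mathcomp Require Import all_boot all_order all_algebra.
From mathcomp Require Import finmap monalg.

Set Implicit Arguments.
Unset Strict Implicit.
Unset Printing Implicit Defensive.

Import GRing.Theory.

Local Open Scope ring_scope.

Inductive letter := LX of nat | LY of nat | LZ of nat.

Definition letter_code (v : letter) : nat + (nat + nat) :=
  match v with LX i => inl i | LY i => inr (inl i) | LZ i => inr (inr i) end.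
Definition letter_decode (c : nat + (nat + nat)) : letter :=
  match c with inl i => LX i | inr (inl i) => LY i | inr (inr i) => LZ i end.
Lemma letter_codeK : cancel letter_code letter_decode.
Proof. by case. Qed.

HB.instance Definition _ := Countable.copy letter (can_type letter_codeK).

(* Polynomials in the infinitely many commuting letters: the algebra over R of
   the free commutative monoid on letter. *)
Notation lpoly R := {malg R[{cmonom letter}]}.

Definition var (R : comNzRingType) (v : letter) : lpoly R := << ucm v >>.
Definition x_ (R : comNzRingType) (i : nat) : lpoly R := var R (LX i).
Definition y_ (R : comNzRingType) (i : nat) : lpoly R := var R (LY i).
Definition z_ (R : comNzRingType) (i : nat) : lpoly R := var R (LZ i).

(* None means that the letter has no production rule. *)
Definition grammar (R : comNzRingType) := letter -> option (lpoly R).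

(* The values on letters without a production rule are left unconstrained. *)
Definition formal_derivative (R : comNzRingType) (G : grammar R)
    (D : lpoly R -> lpoly R) : Prop :=
  [/\ linear D,
      forall f g, D (f * g) = D f * g + f * D g
    & forall v p, G v = Some p -> D (var R v) = p].

Definition G_ (R : comNzRingType) (n : nat) : grammar R := fun v =>
  match v with
  | LX i => if (i < n)%N then Some (x_ R n * y_ R n * z_ R n) else None
  | LY i => if (i < n)%N then Some (2%:R * x_ R n * y_ R n * z_ R n) else None
  | LZ i => if (i < n)%N then Some (x_ R n * y_ R n * z_ R n) else None
  end.

Section Existence.

Let coef1M (S : nzRingType) (p q : {poly S}) :
  (p * q)`_1 = p`_1 * q`_0 + p`_0 * q`_1.
Proof. by rewrite coefM big_ord_recl big_ord1 addrC. Qed.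

Variables (R : comNzRingType) (G : grammar R).

(* The R-algebra morphism v |-> v + G(v) * eps; its eps-coefficient is a
   formal derivative. *)
Let rule v : lpoly R := odflt 0 (G v).
Let mon (m : {cmonom letter}) : {poly lpoly R} :=
  \prod_(v <- finsupp m) ((var R v)%:P + rule v *: 'X) ^+ m v.
Let taylor (p : lpoly R) : {poly lpoly R} :=
  mmap (polyC \o @malgC {cmonom letter} R) mon p.

Let monEw (d : {fset letter}) (m : {cmonom letter}) : (finsupp (cmonom_val m) `<=` d)%fset ->
  mon m = \prod_(v <- d) ((var R v)%:P + rule v *: 'X) ^+ m v.
Proof.
move=> le; rewrite /mon (big_fset_incl _ le) // => v _.
by rewrite -cmE_eq0 => /eqP ->.
Qed.

Let monM : mmorphism mon.
Proof.
split=> [m1 m2|]; last by rewrite /mon mdom1 big_seq_fset0.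
rewrite (monEw (m := mmul m1 m2) (fsubset_refl _)) mdomD.
rewrite (monEw (m := m1) (fsubsetUl _ (finsupp m2))).
rewrite (monEw (m := m2) (fsubsetUr (finsupp m1) _)).
by rewrite -big_split; apply: eq_bigr => v _; rewrite cmM exprD.
Qed.

Let monomE (m : {cmonom letter}) :
  \prod_(v <- finsupp m) var R v ^+ m v = << m >>.
Proof.
have UM (a b : {cmonom letter}) : << mmul a b >> = << a >> * << b >> :> lpoly R.
  by rewrite malgM_def fgmulUU mulr1.
have UX v k : exists2 a : {cmonom letter}, var R v ^+ k = << a >> &
    forall u, a u = ((v == u) * k)%N.
  elim: k => [|k [a IHa aE]].
    by exists mone => [|u]; rewrite ?expr0 ?cm1 ?muln0.
  exists (mmul (ucm v) a) => [|u]; first by rewrite UM exprS IHa.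
  by rewrite cmM cmU aE mulnS.
have [a -> aE] : exists2 a : {cmonom letter},
    \prod_(v <- finsupp m) var R v ^+ m v = << a >> &
    forall u, a u = (\sum_(v <- finsupp m) (v == u) * m v)%N.
  elim: (enum_fset (finsupp m)) => [|v s [a IHa aE]].
    by exists mone => [|u]; rewrite ?big_nil ?cm1.
  have [b Eb bE] := UX v (m v).
  exists (mmul b a) => [|u]; first by rewrite big_cons IHa Eb UM.
  by rewrite cmM bE aE big_cons.
congr (<< _ >>); apply/eqP/cmP => u; rewrite aE.
have [um|] := boolP (u \in finsupp m); last first.
  move=> num; rewrite big_seq big1 => [|v vm].
    by apply/esym/eqP; rewrite cmE_eq0.
  by case: eqP vm num => // -> ->.
rewrite (big_fsetD1 u um) /= eqxx mul1n big_seq big1 ?addn0 // => v.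
by rewrite !inE => /andP[/negPf ->].
Qed.

Let taylor0 p : (taylor p)`_0 = p.
Proof.
rewrite [RHS]monalgE /taylor /mmap coef_sum; apply: eq_bigr => m _ /=.
rewrite coefCM -horner_coef0 /mon horner_prod.
under eq_bigr do rewrite horner_exp hornerD hornerZ hornerC hornerX mulr0 addr0.
by rewrite monomE malgM_def fgmulUU mulr1 mul1m.
Qed.

Lemma formal_derivative_exists :
  exists2 D, formal_derivative G D & forall v, G v = None -> D (var R v) = 0.
Proof.
pose h := MMorphism.Pack (MMorphism.Class (isMultiplicative.Build _ _ _ monM)).
have tM f g : taylor (f * g) = taylor f * taylor g.
  exact: (rmorphM (mmap (polyC \o malgC) h)).
have tD f g : taylor (f + g) = taylor f + taylor g.
  exact: (raddfD (mmap (polyC \o malgC) h)).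
have tC (c : R) : taylor c%:MP = c%:MP%:P.
  exact: (@mmapC _ _ _ (polyC \o @malgC {cmonom letter} R) h).
have D_var v : (taylor (var R v))`_1 = rule v.
  rewrite /taylor mmapU /= mul1r /mon mdomU big_seq_fset1 cmU eqxx expr1.
  by rewrite coefD coefC coefZ coefX mulr1 add0r.
move: taylor0 tM tD tC D_var; move: taylor => t t0 tM tD tC D_var.
exists (fun p => (t p)`_1) => [|v Gv]; last by rewrite D_var /rule Gv.
split=> [c f g|f g|v p Gv]; last by rewrite D_var /rule Gv.
  by rewrite -!mul_malgC tD tM tC coefD coefCM.
by rewrite tM coef1M (t0 f) (t0 g).
Qed.
End Existence.

(* Entries are numbered from 1; nth's default gives entry w 0 = 0 and
   entry w i = 0 for i > size w. *)
Definition entry (w : seq nat) (i : nat) : nat := nth 0%N (0%N :: w) i.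

Definition mset2 (n : nat) : seq nat := flatten [seq [:: k; k] | k <- iota 1 n].

(* Positions 1, ..., 2n are the nonzero elements of 'I_(2 * n).+1. *)
Definition stirling_perm (n : nat) (w : seq nat) : bool :=
  perm_eq w (mset2 n) &&
  [forall i : 'I_(2 * n).+1, forall k : 'I_(2 * n).+1, forall j : 'I_(2 * n).+1,
    [&& 0 < i, i < k, k < j & entry w i == entry w j]%N
      ==> (entry w i < entry w k)%N].

Definition second_occurrence (w : seq nat) (i : nat) : bool :=
  (0 < i)%N && (count_mem (entry w i) (take i w) == 2%N).

Definition markable (w : seq nat) (i : nat) : bool :=
  second_occurrence w i && (entry w i < entry w i.+1)%N.

(* A word on {0, ..., n} together with a set of marked positions. *)
Notation marked_word n := ((2 * n).-tuple 'I_n.+1 * {set 'I_(2 * n).+1})%type.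

Definition word (n : nat) (p : marked_word n) : seq nat := map val p.1.

Definition Qbar (n : nat) : {set marked_word n} :=
  [set p : marked_word n |
    stirling_perm n (word p) && [forall i in p.2, markable (word p) i]].

Definition inA (w : seq nat) (i : nat) : bool := (entry w i.-1 < entry w i)%N.
Definition inD (w : seq nat) (i : nat) : bool := (entry w i > entry w i.+1)%N.
Definition inP (w : seq nat) (i : nat) : bool := entry w i.-1 == entry w i.

Definition weight (R : comNzRingType) (n : nat) (w : seq nat) : lpoly R :=
  (\prod_(1 <= i < (2 * n).+1 | inA w i) x_ R (entry w i)) *
  (\prod_(1 <= i < (2 * n).+1 | inD w i) y_ R (entry w i)) *
  (\prod_(1 <= i < (2 * n).+1 | inP w i) z_ R (entry w i)).

Definition T_ (R : comNzRingType) (n : nat) : lpoly R :=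
  \sum_(p in Qbar n) weight R n (word p).

(* Main.v *)
(* A Stirling permutation w of [n]_2 has 2n+1 gaps between consecutive entries
   of 0 w 0, and its monomial is a product of one letter per gap: x_b at an
   ascent a < b, y_a at a descent a > b, z_a at a plateau.  Inserting the pair
   (n+1)(n+1) in a gap replaces its letter by x_(n+1) z_(n+1) y_(n+1), which is
   what D_(n+1) does to that letter.  The entry a before the gap becomes
   markable if it is a second occurrence; this is always so at a descent (hence
   the coefficient 2 of the rule for y), never at a plateau, and at an ascent it
   was already markable before the insertion.  Marks are thus counted by
   a factor 2 on each ascent gap that follows a second occurrence. *)
Require Import Defs.
From HB Require Import structures.
From mathcomp Require Import all_boot all_order all_algebra.
From mathcomp Require Import finmap monalg.
From mathcomp Require Import zify.

Set Implicit Arguments.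
Unset Strict Implicit.
Unset Printing Implicit Defensive.

Import GRing.Theory.

(** * Entries of words and the nesting condition *)

Lemma mset2S n : mset2 n.+1 = mset2 n ++ [:: n.+1; n.+1].
Proof. by rewrite /mset2 -{1}[n.+1]addn1 iotaD map_cat flatten_cat. Qed.

Lemma size_mset2 n : size (mset2 n) = (2 * n)%N.
Proof. by elim: n => // n IHn; rewrite mset2S size_cat IHn /=; lia. Qed.

Lemma count_mset2 n a : count_mem a (mset2 n) = (2 * (0 < a <= n))%N.
Proof.
elim: n => [|n IHn]; first by case: a.
rewrite mset2S count_cat IHn /= addn0; lia.
Qed.

Lemma entryS (w : seq nat) i : entry w i.+1 = nth 0%N w i.
Proof. by []. Qed.

Lemma entry_default (w : seq nat) i : (size w < i)%N -> entry w i = 0%N.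
Proof. by case: i => // i lt_wi; rewrite entryS nth_default. Qed.

Lemma entry_mem (w : seq nat) i : (0 < i <= size w)%N -> entry w i \in w.
Proof. by case: i => // i /= lt_iw; rewrite entryS mem_nth. Qed.

Lemma mem_drop_entry (w : seq nat) i a :
  a \in drop i w -> exists2 j, (i < j <= size w)%N & entry w j = a.
Proof.
move=> a_in; have := a_in; rewrite -index_mem size_drop => lt_ix.
exists (i + index a (drop i w)).+1.
  by rewrite ltnS leq_addr -ltn_subRL.
by rewrite entryS -nth_drop nth_index.
Qed.

(** Positions are bounded by [size w] rather than taken among ordinals below [(2 * n).+1], so that
    words of different lengths can be compared. *)
Definition nested (w : seq nat) : Prop := forall i k j,
  (0 < i)%N -> (i < k)%N -> (k < j)%N -> (j <= size w)%N ->
  entry w i = entry w j -> (entry w i < entry w k)%N.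

Lemma stirling_permP n w :
  reflect (perm_eq w (mset2 n) /\ nested w) (stirling_perm n w).
Proof.
apply: (iffP andP) => -[w_perm nest_w]; split=> //.
  have size_w : size w = (2 * n)%N by rewrite (perm_size w_perm) size_mset2.
  move=> i k j i_gt0 lt_ik lt_kj; rewrite size_w => le_j eq_ij.
  have lt_j : (j < (2 * n).+1)%N by lia.
  have lt_k : (k < (2 * n).+1)%N by lia.
  have lt_i : (i < (2 * n).+1)%N by lia.
  move/forallP/(_ (Ordinal lt_i))/forallP/(_ (Ordinal lt_k)): nest_w.
  move/forallP/(_ (Ordinal lt_j))/implyP; apply => /=.
  by rewrite i_gt0 lt_ik lt_kj eq_ij eqxx.
have size_w : size w = (2 * n)%N by rewrite (perm_size w_perm) size_mset2.
apply/forallP => i; apply/forallP => k; apply/forallP => j; apply/implyP.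
case/and4P => i_gt0 lt_ik lt_kj /eqP; apply: nest_w => //.
by rewrite size_w -ltnS.
Qed.

(** * Second occurrences at descents and plateaus *)

Section StirlingWord.

Variables (n : nat) (w : seq nat).
Hypothesis w_stirling : stirling_perm n w.

Lemma stirling_perm_size : size w = (2 * n)%N.
Proof.
by case/stirling_permP: w_stirling => /perm_size ->; rewrite size_mset2.
Qed.

Lemma stirling_perm_count a : count_mem a w = (2 * (0 < a <= n))%N.
Proof. by case/stirling_permP: w_stirling => /permP ->; rewrite count_mset2. Qed.

Lemma stirling_perm_mem a : (a \in w) = (0 < a <= n)%N.
Proof. by rewrite -has_pred1 has_count stirling_perm_count; lia. Qed.

Lemma stirling_perm_entry_gt0 i : (0 < i <= size w)%N -> (0 < entry w i)%N.
Proof. by move/entry_mem; rewrite stirling_perm_mem => /andP[]. Qed.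

Lemma stirling_perm_entry_le i : (entry w i <= n)%N.
Proof.
case: (ltnP (size w) i) => [/entry_default -> //|le_i].
case: i le_i => // i le_i.
by have /entry_mem : (0 < i.+1 <= size w)%N by []; rewrite stirling_perm_mem => /andP[].
Qed.

(** Otherwise the second copy of the entry comes later, and not immediately after, since the next
    entry is smaller. That next entry then lies between two equal entries and would have to exceed
    them. *)
Lemma descent_second_occurrence i :
  (i <= size w)%N -> (entry w i.+1 < entry w i)%N -> second_occurrence w i.
Proof.
case: i => // i lt_iw desc; rewrite /second_occurrence /=.
set a := entry w i.+1 in desc *.
have a_in : a \in w by apply: entry_mem.
have cnt : count_mem a w = 2.
  by move: a_in; rewrite stirling_perm_mem stirling_perm_count => ->.
have [a_drop|a_ndrop] := boolP (a \in drop i.+1 w); last first.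
  move: cnt; rewrite -{1}(cat_take_drop i.+1 w) count_cat.
  by rewrite (count_memPn a_ndrop) addn0 => ->.
have [j /andP[lt_ij le_jw] eq_ja] := mem_drop_entry a_drop.
have [_ /(_ i.+1 i.+2 j)] := stirling_permP _ _ w_stirling.
rewrite -/a eq_ja => /(_ isT (ltnSn _)) nest.
have [eq_j|] := eqVneq j i.+2; first by rewrite -eq_j eq_ja ltnn in desc.
by move=> ne_j; have := nest ltac:(lia) le_jw erefl; lia.
Qed.

(** The copy at [i.+1] is one of only two, so the prefix of length [i] contains at most one. *)
Lemma plateau_second_occurrence i :
  (i <= size w)%N -> entry w i.+1 = entry w i -> second_occurrence w i = false.
Proof.
case: i => // i lt_iw plat; rewrite /second_occurrence /=.
(* At the last position the next entry is the default 0, which differs from the positive last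
   entry. *)
have [lt_i1|] := ltnP i.+1 (size w); last first.
  move=> ge_i1; have := @stirling_perm_entry_gt0 i.+1 lt_iw.
  by rewrite -plat entry_default.
set a := entry w i.+1 in plat *.
have := stirling_perm_count a; rewrite -{1}(cat_take_drop i.+2 w) count_cat.
rewrite (take_nth 0%N) // -cats1 count_cat /= -(entryS w i.+1) plat eqxx.
lia.
Qed.

End StirlingWord.

(** * Insertion of an adjacent pair of maximal entries *)

Definition insert2 (N s : nat) (w : seq nat) : seq nat :=
  take s w ++ [:: N, N & drop s w].

Lemma size_insert2 N s w : size (insert2 N s w) = (size w).+2.
Proof. by rewrite size_cat /= !addnS -size_cat cat_take_drop. Qed.

Lemma entry_insert2 N s w j : (s <= size w)%N ->
  entry (insert2 N s w) j =
    if (j <= s)%N then entry w j else if (j <= s.+2)%N then N else entry w j.-2.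
Proof.
move=> le_sw; case: j => // j; rewrite !entryS /insert2 nth_cat size_take_min.
rewrite (minn_idPl le_sw); case: ltnP => [lt_js|le_sj]; first by rewrite nth_take.
have [k ->] : exists k, j = (s + k)%N by exists (j - s)%N; lia.
rewrite addKn; case: k => [|[|k]] /=.
- by rewrite addn0 leqW.
- by rewrite addn1 leqnn.
rewrite !addnS ifN ?entryS ?nth_drop //; lia.
Qed.

Lemma count_insert2 p N s w :
  count p (insert2 N s w) = (count p w + 2 * p N)%N.
Proof. by rewrite -[in RHS](cat_take_drop s w) !count_cat /=; lia. Qed.

Lemma filter_insert2 N s w :
  N \notin w -> [seq a <- insert2 N s w | a != N] = w.
Proof.
move=> Nw; rewrite filter_cat /= eqxx /= -filter_cat cat_take_drop.
by apply/all_filterP/allP => a a_in; apply: contraNneq Nw => <-.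
Qed.

Lemma index_insert2 N s w :
  N \notin w -> (s <= size w)%N -> index N (insert2 N s w) = s.
Proof.
move=> Nw le_sw; rewrite index_cat ifN; last first.
  by apply: contra Nw; apply: mem_take.
by rewrite /= eqxx addn0 size_takel.
Qed.

Section InsertNested.

Variables (N s : nat) (w : seq nat).
Hypotheses (le_sw : (s <= size w)%N) (lt_wN : forall i, (entry w i < N)%N).

(** The shift [sh] embeds the positions of [w] increasingly and preserves entries, which gives one
    direction. Conversely, nothing lies between the two adjacent [N], an [N] in the middle exceeds
    every entry of [w], and all other triples pull back to [w]. *)
Lemma nested_insert2 : nested (insert2 N s w) <-> nested w.
Proof.
split=> nest i k j i_gt0 lt_ik lt_kj.
  pose sh i := if (i <= s)%N then i else i.+2.
  have entry_sh l : entry (insert2 N s w) (sh l) = entry w l.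
    rewrite entry_insert2 // /sh; case: (leqP l s) => [-> //|lt_sl].
    by rewrite !ifN //; lia.
  have lt_sh a b : (a < b)%N -> (sh a < sh b)%N.
    by rewrite /sh; case: (leqP a s); case: (leqP b s); lia.
  have sh_bounds a : (a <= sh a <= a.+2)%N by rewrite /sh; case: ifP; lia.
  move=> le_jw; rewrite -!entry_sh; apply: nest; rewrite ?lt_sh ?size_insert2 //.
    by have := sh_bounds i; lia.
  by have := sh_bounds j; lia.
rewrite size_insert2 => le_jw; rewrite !entry_insert2 //.
have := lt_wN i; have := lt_wN i.-2; have := lt_wN j; have := lt_wN j.-2.
case: (leqP i s) => [le_is|lt_si].
  case: (leqP k s) => [le_ks|lt_sk].
    case: (leqP j s) => [le_js|lt_sj]; first by move=> *; apply: (nest i k j); lia.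
    case: (leqP j s.+2) => [le_js|lt_s2j]; first lia.
    by move=> *; apply: (nest i k j.-2); lia.
  case: (leqP k s.+2) => [le_ks|lt_s2k]; first lia.
  rewrite !ifN; [|lia|lia].
  by move=> *; apply: (nest i k.-2 j.-2); lia.
case: (leqP i s.+2) => [le_is|lt_s2i].
  rewrite [(j <= s)%N]leqNgt (ltn_trans lt_si (ltn_trans lt_ik lt_kj)) /=.
  by case: (leqP j s.+2) => [|_]; lia.
rewrite !ifN; [|lia|lia|lia|lia].
by move=> *; apply: (nest i.-2 k.-2 j.-2); lia.
Qed.

End InsertNested.

Lemma stirling_perm_insert2 n s w : stirling_perm n w -> (s <= size w)%N ->
  stirling_perm n.+1 (insert2 n.+1 s w).
Proof.
move=> w_st le_sw; have [w_perm nest_w] := stirling_permP _ _ w_st.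
apply/stirling_permP; split; last first.
  by apply/nested_insert2 => // i; rewrite ltnS (stirling_perm_entry_le w_st).
apply/permP => p; rewrite count_insert2 mset2S count_cat (permP w_perm) /=; lia.
Qed.

(** An entry between the two copies of the maximum [n.+1] would have to exceed it, so these copies
    are adjacent and can be deleted. *)
Lemma stirling_permS n w : stirling_perm n.+1 w ->
  exists s v, [/\ stirling_perm n v, (s <= size v)%N & w = insert2 n.+1 s v].
Proof.
move=> w_st; have [w_perm nest_w] := stirling_permP _ _ w_st.
have cntN : count_mem n.+1 w = 2.
  by rewrite (stirling_perm_count w_st) leqnn.
have N_in : n.+1 \in w by rewrite (stirling_perm_mem w_st) leqnn.
pose s := index n.+1 w.
have lt_sw : (s < size w)%N by rewrite index_mem.
have entry_s : entry w s.+1 = n.+1 by rewrite entryS nth_index.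
have eq_w : w = take s w ++ n.+1 :: drop s.+1 w.
  by rewrite -[LHS](cat_take_drop s w) (drop_nth 0%N) // -entryS entry_s.
have N_take : n.+1 \notin take s w.
  by apply/negP => /index_ltn; rewrite ltnn.
have N_drop : n.+1 \in drop s.+1 w.
  apply/negPn/negP => /count_memPn N0; move: cntN.
  by rewrite eq_w count_cat (count_memPn N_take) /= eqxx N0.
have [j /andP[lt_sj le_jw] entry_j] := mem_drop_entry N_drop.
have {lt_sj} eq_j : j = s.+2.
  apply/eqP; rewrite eqn_leq lt_sj andbT leqNgt; apply/negP => lt_s2j.
  have := nest_w s.+1 s.+2 j isT (ltnSn _) lt_s2j le_jw.
  rewrite entry_s entry_j => /(_ erefl).
  by rewrite ltnNge (stirling_perm_entry_le w_st).
rewrite {}eq_j in entry_j le_jw.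
exists s, (take s w ++ drop s.+2 w).
have size_v : (s <= size (take s w ++ drop s.+2 w))%N.
  by rewrite size_cat size_takel ?leq_addr // ltnW.
have eq_w2 : w = insert2 n.+1 s (take s w ++ drop s.+2 w).
  rewrite /insert2 take_size_cat ?drop_size_cat ?size_takel ?(ltnW lt_sw) //.
  by rewrite {1}eq_w (drop_nth 0%N) // -entryS entry_j.
split=> //; move: (take s w ++ _) size_v eq_w2 => v size_v eq_w2.
have v_perm : perm_eq v (mset2 n).
  apply/permP => p; have /permP/(_ p) := w_perm.
  rewrite eq_w2 count_insert2 mset2S count_cat /=; lia.
apply/stirling_permP; split=> //.
move: nest_w; rewrite eq_w2 => /nested_insert2; apply=> // i.
(* The bound on entries is read off the multiset, since [v] is not yet known to be a Stirling
   permutation; outside the word the entry is 0. *)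
have [/andP[i_gt0 le_iv]|i_out] := boolP (0 < i <= size v)%N.
  have /entry_mem : (0 < i <= size v)%N by rewrite i_gt0.
  by rewrite (perm_mem v_perm) -has_pred1 has_count count_mset2; lia.
case: i i_out => // i i_out; rewrite entry_default //; lia.
Qed.

(** * Enumeration of Stirling permutations by word and insertion gap *)

Fixpoint stirling_words (n : nat) : seq (seq nat) :=
  if n is m.+1 then
    [seq insert2 n s w | w <- stirling_words m, s <- index_iota 0 (2 * m).+1]
  else [:: [::]].

Lemma mem_stirling_words n w : (w \in stirling_words n) = stirling_perm n w.
Proof.
elim: n w => [|n IHn] w.
  rewrite inE; apply/eqP/stirling_permP => [->|[/perm_size /= /size0nil //]].
  by split=> // i k j; rewrite leqn0 => _ _ + /eqP j0; rewrite j0.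
apply/allpairsP/idP => [[[v s] [v_in]]|/stirling_permS].
  rewrite IHn mem_index_iota ltnS /= in v_in * => le_s ->.
  by apply: stirling_perm_insert2; rewrite ?(stirling_perm_size v_in).
case=> s [v [v_st le_sv ->]]; exists (v, s); split=> //.
  by rewrite IHn.
by rewrite mem_index_iota ltnS -(stirling_perm_size v_st).
Qed.

(** Insertion is injective: deleting [n.+1] recovers the word, and the first index of [n.+1]
    recovers the gap. *)
Lemma stirling_words_uniq n : uniq (stirling_words n).
Proof.
elim: n => // n IHn; apply: allpairs_uniq => //; first exact: iota_uniq.
move=> [v1 s1] [v2 s2] /allpairsP[[a b] [a_st le_b [-> ->]]].
case/allpairsP=> [[c d] [c_st le_d [-> ->]]].
rewrite mem_stirling_words /= in a_st; rewrite mem_stirling_words /= in c_st.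
rewrite mem_index_iota ltnS /= in le_b; rewrite mem_index_iota ltnS /= in le_d.
have aN : n.+1 \notin a by rewrite (stirling_perm_mem a_st) ltnn.
have cN : n.+1 \notin c by rewrite (stirling_perm_mem c_st) ltnn.
rewrite -(stirling_perm_size a_st) in le_b.
rewrite -(stirling_perm_size c_st) in le_d; move=> /= eq_ins; congr (_, _).
  by rewrite -(filter_insert2 b aN) eq_ins filter_insert2.
by rewrite -(index_insert2 aN le_b) eq_ins index_insert2.
Qed.

Lemma second_occurrence_insert2 N s w i : (s <= size w)%N -> (i <= s)%N ->
  second_occurrence (insert2 N s w) i = second_occurrence w i.
Proof.
move=> le_sw le_is; rewrite /second_occurrence entry_insert2 // le_is.
rewrite /insert2 takel_cat ?size_takel // take_takel //.
Qed.

(** The prefix gains only two copies of [N], which differs from the entry being counted. *)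
Lemma second_occurrence_insert2_shift N s w i :
  (s <= size w)%N -> (s < i)%N -> (entry w i < N)%N ->
  second_occurrence (insert2 N s w) i.+2 = second_occurrence w i.
Proof.
move=> le_sw lt_si lt_N; rewrite /second_occurrence entry_insert2 // !ifN; [|lia|lia].
have -> : take i.+2 (insert2 N s w) = insert2 N s (take i w).
  rewrite /insert2 take_cat size_takel // ifN; last lia.
  rewrite take_takel ?(ltnW lt_si) //; congr (_ ++ _).
  rewrite !subSn; [|lia|lia]; rewrite /= -{2}(subnK (ltnW lt_si)).
  by rewrite take_drop.
rewrite count_insert2 /= !eqn_leq (ltnW lt_N) [(N <= _)%N]leqNgt lt_N /=.
by rewrite muln0 addn0 /=; case: i lt_si {lt_N}.
Qed.

Local Open Scope ring_scope.

(** * Products over gaps, with letters evaluated in any commutative ring *)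

Definition gap_letter (w : seq nat) (i : nat) : letter :=
  if (entry w i < entry w i.+1)%N then LX (entry w i.+1)
  else if (entry w i.+1 < entry w i)%N then LY (entry w i)
  else LZ (entry w i.+1).

Section Weight.

Variables (A : comNzRingType) (ev : letter -> A).

(** The factor [F s] disappears because insertion destroys gap [s]; three new gaps, with letters in
    the order x, z, y, take its place. *)
Lemma prod_insert2 (F F' : nat -> A) s m x y z k : (s <= m)%N ->
    (forall i, (i < s)%N -> F' i = F i) ->
    (forall i, (s < i)%N -> F' i.+2 = F i) ->
    F' s = x *+ k -> F' s.+1 = z -> F' s.+2 = y ->
  \prod_(0 <= i < m.+3) F' i =
  \prod_(0 <= i < s) F i * (x * y * z *+ k) * \prod_(s.+1 <= i < m.+1) F i.
Proof.
move=> le_sm F_lo F_hi F_s F_s1 F_s2.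
have tail : \prod_(s.+3 <= i < m.+3) F' i = \prod_(s.+1 <= i < m.+1) F i.
  rewrite -[s.+3]addn2 big_addn subn2; apply: eq_big_nat => i /andP[lt_si _].
  by rewrite addn2 F_hi.
rewrite (big_cat_nat (n := s)) //=; last lia.
rewrite (eq_big_nat _ _ (F2 := F)); last by move=> i; apply: F_lo.
rewrite -[RHS]mulrA; congr (_ * _).
do 3 (rewrite big_ltn; last lia); rewrite tail !mulrA F_s F_s1 F_s2.
by rewrite [_ *+ _ * z * y]mulrAC !mulrnAl.
Qed.

(* For the empty word the only gap carries z_0, although weight has no factor
   there: this makes z_0 the case n = 0 of the recursion. *)
Definition gap_factor (w : seq nat) (i : nat) : A :=
  ev (gap_letter w i) *+ (markable w i).+1.

(** The new gaps are an ascent to [N], a plateau and a descent from [N]. Only the ascent can carry a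
    mark, exactly when position [s] is a second occurrence. *)
Lemma prod_gap_factor_insert2 N s w :
  (s <= size w)%N -> (forall i, (entry w i < N)%N) ->
  \prod_(0 <= i < (size w).+3) gap_factor (insert2 N s w) i =
  \prod_(0 <= i < s) gap_factor w i *
  (ev (LX N) * ev (LY N) * ev (LZ N) *+ (second_occurrence w s).+1) *
  \prod_(s.+1 <= i < (size w).+1) gap_factor w i.
Proof.
move=> le_sw lt_N; rewrite /gap_factor /gap_letter /markable.
have entry_lo i : (i <= s)%N -> entry (insert2 N s w) i = entry w i.
  by move=> le_is; rewrite entry_insert2 // le_is.
have entry_hi i : (s < i)%N -> entry (insert2 N s w) i.+2 = entry w i.
  by move=> lt_si; rewrite entry_insert2 // !ifN //; lia.
have entry_s1 : entry (insert2 N s w) s.+1 = N.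
  by rewrite entry_insert2 // ltnn leqnSn.
have entry_s2 : entry (insert2 N s w) s.+2 = N.
  by rewrite entry_insert2 // leqnn ifN //; lia.
apply: prod_insert2 => // [i lt_is|i lt_si|||].
- by rewrite second_occurrence_insert2 ?(ltnW lt_is) // !entry_lo // ltnW.
- by rewrite second_occurrence_insert2_shift // !entry_hi // ltnW.
- by rewrite second_occurrence_insert2 // entry_s1 entry_lo // lt_N andbT.
- by rewrite entry_s1 entry_s2 ltnn andbF.
- by rewrite entry_s2 entry_hi // lt_N ltnNge (ltnW (lt_N _)) andbF.
Qed.

(** * Derivations applied to products over gaps *)

Section Derivation.

Variables (D : A -> A).
Hypotheses (DD : {morph D : f g / f + g}).
Hypotheses (DM : forall f g, D (f * g) = D f * g + f * D g).

Lemma derivation0 : D 0 = 0.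
Proof. by apply: (addrI (D 0)); rewrite -DD !addr0. Qed.

Lemma derivationMn f k : D (f *+ k) = D f *+ k.
Proof. by elim: k => [|k IHk]; rewrite ?derivation0 // !mulrS DD IHk. Qed.

Lemma derivation1 : D 1 = 0.
Proof.
by have := DM 1 1; rewrite !mulr1 mul1r => D1; apply: (addrI (D 1)); rewrite addr0.
Qed.

Lemma derivation_prod (F : nat -> A) m :
  D (\prod_(0 <= i < m) F i) = \sum_(0 <= i < m)
    \prod_(0 <= j < i) F j * D (F i) * \prod_(i.+1 <= j < m) F j.
Proof.
elim: m => [|m IHm]; first by rewrite !big_geq // derivation1.
rewrite big_nat_recr // [RHS]big_nat_recr //= DM IHm [\prod_(m.+1 <= j < m.+1) F j]big_geq // mulr1 mulr_suml.
congr (_ + _); apply: eq_big_nat => i /andP[_ lt_im].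
by rewrite big_nat_recr //= mulrA.
Qed.

Variable n : nat.
Let xyz := ev (LX n.+1) * ev (LY n.+1) * ev (LZ n.+1).
Hypotheses (DX : forall i, (i <= n)%N -> D (ev (LX i)) = xyz)
  (DY : forall i, (i <= n)%N -> D (ev (LY i)) = xyz *+ 2)
  (DZ : forall i, (i <= n)%N -> D (ev (LZ i)) = xyz).

(* The factor 2 of a descent letter is the choice of marking the entry before
   the inserted pair; at an ascent that choice is already in gap_factor. *)
Lemma derivation_gap_factor w i : stirling_perm n w -> (i <= size w)%N ->
  D (gap_factor w i) = xyz *+ (second_occurrence w i).+1.
Proof.
move=> w_st le_iw; rewrite derivationMn /markable /gap_letter.
(* Every letter of the word has index at most [n], so a rule applies to it. *)
have le_n := stirling_perm_entry_le w_st; case: ltngtP => [asc|desc|plat].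
- by rewrite DX // andbT.
- by rewrite DY // andbF (descent_second_occurrence w_st).
- by rewrite DZ // andbF (plateau_second_occurrence w_st).
Qed.

(** The Leibniz rule selects a word and one of its gaps, which are the pairs indexing
    [stirling_words n.+1]; the two sums agree term by term. *)
Lemma derivation_stirling_words :
  D (\sum_(w <- stirling_words n) \prod_(0 <= i < (2 * n).+1) gap_factor w i) =
  \sum_(w <- stirling_words n.+1) \prod_(0 <= i < (2 * n.+1).+1) gap_factor w i.
Proof.
have -> : stirling_words n.+1 = [seq insert2 n.+1 s w |
  w <- stirling_words n, s <- index_iota 0 (2 * n).+1] by [].
rewrite (big_morph D DD derivation0) big_allpairs_dep !big_seq.
apply: eq_bigr => w; rewrite mem_stirling_words => w_st.
rewrite derivation_prod; apply: eq_big_nat => s /andP[_].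
rewrite ltnS -(stirling_perm_size w_st) => le_sw.
rewrite derivation_gap_factor // mulnS -(stirling_perm_size w_st).
rewrite prod_gap_factor_insert2 // => i.
by rewrite ltnS (stirling_perm_entry_le w_st).
Qed.

End Derivation.

(** * Return to the three index sets and to marked words *)

(** Each gap is exactly one of ascent, descent and plateau. Ascents and plateaus are indexed by the
    right end of the gap, descents by the left end. *)
Lemma prod_gap_factor_split n w : (0 < n)%N -> stirling_perm n w ->
  \prod_(0 <= i < (2 * n).+1) gap_factor w i =
  (\prod_(1 <= i < (2 * n).+1 | inA w i) ev (LX (entry w i))) *
  (\prod_(1 <= i < (2 * n).+1 | inD w i) ev (LY (entry w i))) *
  (\prod_(1 <= i < (2 * n).+1 | inP w i) ev (LZ (entry w i))) *+
    2 ^ #|[set i : 'I_(2 * n).+1 | markable w i]|.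
Proof.
move=> n_gt0 w_st; have size_w := stirling_perm_size w_st.
have last_gt0 : (0 < entry w (2 * n))%N.
  by apply: (stirling_perm_entry_gt0 w_st); rewrite size_w; lia.
have end0 : entry w (2 * n).+1 = 0%N by rewrite entry_default // size_w.
rewrite prodrMn; congr (_ *+ _); last first.
  rewrite big_mkord -prod_nat_const.
  rewrite [RHS]big_mkcond; apply: eq_bigr => i _.
  by rewrite inE; case: markable.
(* Position [i] corresponds to gap [i.-1]; the extra last gap ends in 0 and is no ascent. *)
have -> : \prod_(1 <= i < (2 * n).+1 | inA w i) ev (LX (entry w i)) =
    \prod_(0 <= i < (2 * n).+1)
      if (entry w i < entry w i.+1)%N then ev (LX (entry w i.+1)) else 1.
  rewrite big_nat_recr //= end0 ltn0 mulr1 big_add1 big_mkcond.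
  by apply: eq_bigr.
(* Here the extra gap is gap 0, which starts from 0 and is no descent. *)
have -> : \prod_(1 <= i < (2 * n).+1 | inD w i) ev (LY (entry w i)) =
    \prod_(0 <= i < (2 * n).+1)
      if (entry w i.+1 < entry w i)%N then ev (LY (entry w i)) else 1.
  rewrite [RHS]big_ltn //= mul1r big_mkcond.
  by apply: eq_bigr.
(* The last gap is no plateau because the last entry is positive, which uses [0 < n]. *)
have -> : \prod_(1 <= i < (2 * n).+1 | inP w i) ev (LZ (entry w i)) =
    \prod_(0 <= i < (2 * n).+1)
      if entry w i == entry w i.+1 then ev (LZ (entry w i.+1)) else 1.
  rewrite big_nat_recr //= end0 eqn0Ngt last_gt0 mulr1 big_add1 big_mkcond.
  by apply: eq_bigr.
rewrite -!big_split; apply: eq_bigr => i _ /=; rewrite /gap_letter.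
by case: ltngtP; rewrite ?mulr1 ?mul1r.
Qed.

End Weight.

(** The sets of marks allowed on a fixed word form the power set of its markable positions, and [F]
    ignores marks. *)
Lemma sum_marked_words (A : nmodType) n (F : seq nat -> A) :
  \sum_(p in Qbar n) F (word p) = \sum_(w <- stirling_words n)
    F w *+ 2 ^ #|[set i : 'I_(2 * n).+1 | markable w i]|.
Proof.
pose wd (t : (2 * n).-tuple 'I_n.+1) : seq nat := map val t.
pose marks t := [set i : 'I_(2 * n).+1 | markable (wd t) i].
have -> : \sum_(p in Qbar n) F (word p) =
    \sum_(t | stirling_perm n (wd t)) F (wd t) *+ 2 ^ #|marks t|.
  rewrite (eq_bigl (fun p : marked_word n =>
    stirling_perm n (wd p.1) && (p.2 \in powerset (marks p.1)))); last first.
    move=> p; rewrite !inE; congr (_ && _); apply/forall_inP/subsetP => sub i.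
      by move=> /sub; rewrite inE.
    by move=> /sub; rewrite inE.
  rewrite -(pair_big_dep (fun t => stirling_perm n (wd t))
    (fun t M => M \in powerset (marks t)) (fun t _ => F (wd t))) /=.
  by apply: eq_bigr => t _; rewrite sumr_const card_powerset.
pose G w := F w *+ 2 ^ #|[set i : 'I_(2 * n).+1 | markable w i]|.
rewrite -big_filter -(big_map wd xpredT G); apply: perm_big.
apply: uniq_perm.
- rewrite map_inj_uniq ?filter_uniq ?index_enum_uniq // => t u eq_tu.
  exact/val_inj/(inj_map val_inj).
- exact: stirling_words_uniq.
move=> w; rewrite mem_stirling_words; apply/mapP/idP => [[t]|w_st].
  by rewrite mem_filter => /andP[t_st _] ->.
(* All entries are at most [n], so [inord] loses nothing and this tuple is a preimage of [w]. *)
have size_w : size [seq (inord a : 'I_n.+1) | a <- w] == (2 * n)%N.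
  by rewrite size_map (stirling_perm_size w_st).
have wdK : w = wd (Tuple size_w).
  rewrite /wd /= -map_comp -[LHS]map_id; apply/eq_in_map => a.
  by rewrite (stirling_perm_mem w_st) => /andP[_ le_an] /=; rewrite inordK.
by exists (Tuple size_w); rewrite // mem_filter -wdK w_st mem_index_enum.
Qed.

Lemma mul2r3 (A : comNzRingType) (x y z : A) :
  2%:R * x * y * z = x * y * z *+ 2.
Proof. by rewrite -!mulrA mulr_natl. Qed.

Theorem theorem4p2 (R : comNzRingType) (D : nat -> lpoly R -> lpoly R)
    (hD : forall m : nat, (0 < m)%N -> formal_derivative (G_ R m) (D m))
    (n : nat) (hn : (0 < n)%N) :
  foldl (fun p m => D m p) (z_ R 0) (iota 1 n) = T_ R n.
Proof.
have -> : foldl (fun p m => D m p) (z_ R 0) (iota 1 n) =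
    \sum_(w <- stirling_words n)
      \prod_(0 <= i < (2 * n).+1) gap_factor (var R) w i.
  (* The induction starts at 0: the single gap of the empty word is a plateau at 0, with letter z_0
     and no mark. *)
  elim: n {hn} => [|n IHn]; first by rewrite big_seq1 big_nat1.
  rewrite -{1}[n.+1]addn1 iotaD foldl_cat IHn add1n.
  have [D_lin D_mul D_var] := hD n.+1 isT.
  apply: derivation_stirling_words => [f g|f g|i le_in|i le_in|i le_in].
  (* Additivity is linearity with scalar 1. *)
  - by have := D_lin 1 f g; rewrite !scale1r.
  - exact: D_mul.
  - by apply: D_var; rewrite /G_ ltnS le_in.
  - apply: etrans (mul2r3 (x_ R n.+1) (y_ R n.+1) (z_ R n.+1)).
    by apply: D_var; rewrite /G_ ltnS le_in.
  - by apply: D_var; rewrite /G_ ltnS le_in.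
rewrite /T_ (sum_marked_words n (weight R n)).
apply: eq_big_seq => w; rewrite mem_stirling_words => w_st.
exact: prod_gap_factor_split.
Qed.
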